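(* Let $f:\mathbb{R}\to\mathbb{R}$ be continuous. If $f$ has a periodic point of least period $n$, then $f$ also has a periodic point of least period $m$ for any positive integer $m$ with $m\triangleleft n$, where $\triangleleft$ is the Sharkovsky ordering of the positive integers \[1 \triangleleft 2 \triangleleft 4 \triangleleft \cdots \cdots 28 \triangleleft 20 \triangleleft 12 \triangleleft \cdots 14 \triangleleft 10 \triangleleft 6 \cdots 7 \triangleleft 5 \triangleleft 3.\]
   Context: For a positive integer $n$, $f^n$ denotes the $n$-fold composition of $f$ with itself. A point $x$ is periodic with least period $n$ if $n$ is the least positive integer with $f^n(x)=x$. The Sharkovsky ordering $\triangleleft$ is the total ordering of the positive integers defined as follows. The powers of two come first (on the left), in ascending order: $2^l\triangleleft 2^k$ if $l<k$. Every power of two precedes every positive integer that is not a power of two. If $2^k m$ and $2^l n$ are given, where $m,n>1$ are odd: if $k\neq l$, the integer with the larger power of two is the smaller one (to the left) with respect to $\triangleleft$; if $k=l$, the integer with the larger odd factor is the smaller one (to the left) with respect to $\triangleleft$. *)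

(* Defs.v *)
From mathcomp Require Import all_boot all_order all_algebra.
From mathcomp Require Import all_classical all_reals all_analysis.

Set Implicit Arguments.
Unset Strict Implicit.
Unset Printing Implicit Defensive.

Definition least_period (T : Type) (f : T -> T) (n : nat) (x : T) : Prop :=
  [/\ (0 < n)%N, iter n f x = x &
      forall k : nat, (0 < k < n)%N -> iter k f x <> x].

Definition is_pow2 (n : nat) : Prop := exists k : nat, n = (2 ^ k)%N.

(* [sharkovsky_lt m n] means that m lies strictly to the left of n; it holds
   only for positive m and n. *)
Inductive sharkovsky_lt : nat -> nat -> Prop :=
| sharkovsky_pow2 (l k : nat) :
    (l < k)%N -> sharkovsky_lt (2 ^ l) (2 ^ k)
| sharkovsky_pow2_other (m n : nat) :
    is_pow2 m -> (0 < n)%N -> ~ is_pow2 n -> sharkovsky_lt m n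
| sharkovsky_larger_pow2 (k l m n : nat) :
    odd m -> (1 < m)%N -> odd n -> (1 < n)%N ->
    (l < k)%N -> sharkovsky_lt (2 ^ k * m) (2 ^ l * n)
| sharkovsky_larger_odd (k m n : nat) :
    odd m -> (1 < m)%N -> odd n -> (1 < n)%N ->
    (n < m)%N -> sharkovsky_lt (2 ^ k * m) (2 ^ k * n).

(* Main.v *)
Require Import Defs.
From mathcomp Require Import all_boot all_order all_algebra.
From mathcomp Require Import all_classical all_reals all_analysis.
From mathcomp Require Import lra zify.
Import numFieldNormedType.Exports.
Import Order.TTheory GRing.Theory Num.Theory.

Set Implicit Arguments.
Unset Strict Implicit.
Unset Printing Implicit Defensive.

(** Why the theorem holds (the argument follows B.-S. Du).

    Everything reduces to three facts about a continuous [f] with a point of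
    least period [n]: if [n > 2] there is one of least period 2
    ([period2_of_period_gt2]); if [n > 1] is odd there is one of every larger
    odd least period ([larger_odd_periods]) and one of every even least period
    ([even_periods]).

    All three are read off one picture, [square_gap].  Let [a] be the least
    point of the cycle and [b] its predecessor, and choose [v] below a fixed
    point [z] with [f v = b], so that [f (f v) = a < v].  Since [f (f a) > a]
    and [f (f z) = z], the point [v] lies in a gap [(y, w)] between consecutive
    fixed points of [f o f]; on this gap [f o f] lies below the diagonal, and
    [f] cannot take the value [z] there, hence stays above [z].
    - [y] is sent above [z] and back: it has least period 2.
    - For odd [k], [f^k y = f y > y].  A fixed point [c] of [f^k] in [(y, v]]
      satisfies [f^(k+2) c = f (f c) < c], so [f^(k+2)] has a fixed point
      strictly between [y] and [c].
    - For odd [n] the cycle of [a] under [f o f] is the whole cycle, hence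
      jumps over [w].  This gives [d < y] with [f (f d) = w], and with
      [f (f v) = a <= d] it makes [f o f] a horseshoe on [[d, w]]; there a fixed
      point of the [k]-th power lies above a fixed point of the [k+1]-st.
    The last two observations give least periods through the same device,
    [least_period_by_descent]: if fixed points of [F^k] always have fixed points
    of [F^(k+s)] below them, then the least fixed point of [F^n] cannot have a
    smaller period [k], for then a fixed point of [F^n] would lie below it.

    The passage to arbitrary [n = 2^k q] goes through [f^(2^k)], which has a
    point of period [q].  Conversely a point of least period [e > 1] for
    [f^(2^k)] yields some point of least period [2^k e] for [f]
    ([pow2_multiple_period]); one factor 2 at a time, this is automatic for
    even [e], and for odd [e] the point might have period [e] itself, in which
    case [even_periods] supplies a point of period [2 e].  Period 1 is the
    intermediate value theorem ([fixed_point_of_period_gt1]). *)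

(** * Extremal crossings of continuous functions *)

Lemma continuous_iter (T : topologicalType) (f : T -> T) (n : nat) :
  continuous f -> continuous (iter n f).
Proof.
move=> cf; elim: n => [|n IHn] x; first exact: cvg_id.
exact: continuous_comp (IHn x) (cf _).
Qed.

(** An intermediate value theorem that selects the crossing point nearest to
    [b]: the crossing is the supremum of the closed set where [h <= g]. *)
Lemma last_crossing (R : realType) (g h : R -> R) (a b : R) :
  continuous g -> continuous h -> (a <= b)%R -> (h a <= g a)%R ->
  (g b < h b)%R ->
  exists c, [/\ (a <= c < b)%R, g c = h c &
    forall x, (c < x <= b)%R -> (g x < h x)%R].
Proof.
move=> cg ch leab hga ghb.
pose k x := (g x - h x)%R.
have ck : continuous k by move=> x; apply: cvgB; [exact: cg|exact: ch].
pose S := ([set x | 0 <= k x] `&` [set x | a <= x <= b])%classic%R.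
have closedS : closed S.
  apply: closedI.
    exact: ((continuous_closedP _).1 ck _ (@closed_ge _ 0%R)).
  rewrite (_ : [set x | _] = [set x | a <= x] `&` [set x | x <= b])%classic%R.
    by apply: closedI; [exact: closed_ge|exact: closed_le].
  by apply/seteqP; split => x /= => [/andP[]//|[-> ->]].
have Sa : S a by split; rewrite /= ?lexx ?leab ?subr_ge0.
have ubS : has_ubound S by exists b => x [_ /= /andP[]].
have [] : S (sup S) by apply: closedS; apply: closure_sup => //; exists a.
set c := sup S => /= kc /andP[leac lecb].
have kneg x : (c < x <= b)%R -> (k x < 0)%R.
  move=> /andP[ltcx lexb]; rewrite ltNge; apply/negP => kx.
  suff: (x <= c)%R by rewrite leNgt ltcx.
  apply: (ub_le_sup ubS); split => //=.
  by rewrite lexb andbT (le_trans leac (ltW ltcx)).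
have kb : (k b < 0)%R by rewrite subr_lt0.
have k0 : (Num.min (k c) (k b) <= 0 <= Num.max (k c) (k b))%R.
  by rewrite ge_min (ltW kb) orbT le_max kc.
have [d] := IVT lecb (continuous_subspaceT ck) k0.
rewrite in_itv /= => /andP[lecd ledb] kd.
have eqcd : c = d.
  apply/eqP; rewrite eq_le lecd leNgt; apply/negP => ltcd.
  by have := kneg d; rewrite ltcd ledb kd ltxx => /(_ isT).
exists c; split.
- rewrite leac lt_neqAle lecb andbT; apply/eqP => eqcb.
  by move: kb; rewrite -eqcb ltNge kc.
- by apply/eqP; rewrite -subr_eq0; apply/eqP; rewrite eqcd.
- by move=> x /kneg; rewrite subr_lt0.
Qed.

Lemma first_crossing (R : realType) (g h : R -> R) (a b : R) :
  continuous g -> continuous h -> (a <= b)%R -> (g a < h a)%R ->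
  (h b <= g b)%R ->
  exists c, [/\ (a < c <= b)%R, g c = h c &
    forall x, (a <= x < c)%R -> (g x < h x)%R].
Proof.
move=> cg ch leab gha hgb.
have cN (k : R -> R) : continuous k -> continuous (k \o @GRing.opp R).
  by move=> ck x; apply: continuous_comp; [exact: opp_continuous|exact: ck].
have [|||c [/andP[lebc ltca] eqc ltc]] :=
  @last_crossing R (g \o @GRing.opp R) (h \o @GRing.opp R)
    (- b)%R (- a)%R (cN _ cg) (cN _ ch).
- by rewrite lerN2.
- by rewrite /= opprK.
- by rewrite /= opprK.
exists (- c)%R; split => //.
- by apply/andP; split; lra.
- move=> x /andP[leax ltxc].
  have := ltc (- x)%R; rewrite /= opprK; apply; apply/andP; split; lra.
Qed.

(** * Least periods *)

Lemma iter_mul_fixed {T : Type} {f : T -> T} {n : nat} {x : T} (q : nat) :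
  iter n f x = x -> iter (q * n) f x = x.
Proof. by move=> fx; rewrite iterM iter_fix. Qed.

Lemma least_period_dvd (T : Type) (f : T -> T) (n k : nat) (x : T) :
  least_period f n x -> iter k f x = x -> (n %| k)%N.
Proof.
move=> [n_gt0 fn least] fk; rewrite /dvdn; apply/eqP.
case: (posnP (k %% n)%N) => // r_gt0; exfalso.
apply: (least (k %% n)%N); first by rewrite r_gt0 ltn_mod.
by move: fk; rewrite {1}(divn_eq k n) addnC iterD iter_mul_fixed.
Qed.

Lemma least_period_exists (T : Type) (f : T -> T) (n : nat) (x : T) :
  (0 < n)%N -> iter n f x = x ->
  exists2 k, least_period f k x & (k %| n)%N.
Proof.
move=> n_gt0 fn.
have ex : exists k, (0 < k)%N && `[< iter k f x = x >].
  by exists n; rewrite n_gt0; apply/asboolP.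
case: (ex_minnP ex) => k /andP[k_gt0 /asboolP fk] leastk.
have lpk : least_period f k x.
  split=> // j /andP[j_gt0 ltjk] fj; suff : (k <= j)%N by rewrite leqNgt ltjk.
  by apply: leastk; rewrite j_gt0; apply/asboolP.
by exists k => //; apply: least_period_dvd lpk fn.
Qed.

(** * Least periods from descending fixed points *)

Lemma fixed_points_descend (R : realType) (F : R -> R) (s i : nat) (d e : R) :
  (forall k c, (0 < k)%N -> k = i %[mod s] -> (d < c <= e)%R ->
     iter k F c = c ->
     exists2 c', (d < c' < c)%R & iter (k + s) F c' = c') ->
  forall k c j, (0 < k)%N -> k = i %[mod s] -> (d < c <= e)%R ->
  iter k F c = c ->
  exists2 c', (d < c' < c)%R & iter (k + s * j.+1) F c' = c'.
Proof.
move=> step k c j k_gt0 ks dce Fc.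
elim: j => [|j [c1 /andP[dc1 c1c] Fc1]]; first by rewrite muln1; exact: step.
have [|||c2 /andP[dc2 c2c1] Fc2] := step (k + s * j.+1)%N c1 _ _ _ Fc1.
- by rewrite addn_gt0 k_gt0.
- by rewrite mulnC addnC modnMDl.
- by case/andP: dce => _ ce; rewrite dc1; apply: ltW; apply: lt_le_trans ce.
exists c2; first by rewrite dc2 (lt_trans c2c1).
by rewrite mulnS (addnC s) addnA.
Qed.

(** The least fixed point of [F^n] above [d] exists because [F^n d > d].  If its
    period [k] were smaller than [n], then descending from [k] to [n] in steps
    of [s] would produce a fixed point of [F^n] below it; the divisibility
    hypothesis ensures that [n] is reached by such steps from any possible
    period. *)
Lemma least_period_by_descent (R : realType) (F : R -> R) (s n : nat)
    (d e : R) :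
  continuous F -> (0 < n)%N ->
  (forall k, (k %| n)%N -> k = n %[mod s]) ->
  (forall k c, (0 < k)%N -> k = n %[mod s] -> (d < c <= e)%R ->
     iter k F c = c ->
     exists2 c', (d < c' < c)%R & iter (k + s) F c' = c') ->
  (d < iter n F d)%R ->
  (exists k c, [/\ (0 < k <= n)%N, k = n %[mod s], (d < c <= e)%R &
     iter k F c = c]) ->
  exists2 p, (d < p <= e)%R & least_period F n p.
Proof.
move=> cF n_gt0 divn step Fd [k0 [c0 [/andP[k0_gt0 k0n] k0s dc0 Fc0]]].
have below k c : (0 < k < n)%N -> k = n %[mod s] -> (d < c <= e)%R ->
    iter k F c = c -> exists2 c', (d < c' < c)%R & iter n F c' = c'.
  move=> /andP[k_gt0 ltkn] ks dc Fc.
  have /dvdnP[j nkj] : (s %| n - k)%N.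
    by rewrite -eqn_mod_dvd ?(ltnW ltkn)// ks.
  case: j nkj => [|j] nkj; first by lia.
  have -> : n = (k + s * j.+1)%N by lia.
  exact: (fixed_points_descend step).
have [c /andP[dc ce] Fc] : exists2 c, (d < c <= e)%R & iter n F c = c.
  case: (ltngtP k0 n) k0n => // [ltk0n|eqk0n] _.
    have [|c /andP[dc cc0] Fc] := below k0 c0 _ k0s dc0 Fc0.
      by rewrite k0_gt0.
    by exists c => //; apply/andP; split; case/andP: dc0 => ? ?; lra.
  by exists c0; rewrite -?eqk0n.
have [|||||p [/andP[dp pc] Fp ltp]] := @first_crossing R id (iter n F) d c.
- exact: (fun x => @cvg_id _ _).
- exact: continuous_iter.
- exact: ltW.
- by [].
- by rewrite Fc.
have pe : (d < p <= e)%R by rewrite dp (le_trans pc).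
exists p => //.
have [k lpk dvdkn] := least_period_exists n_gt0 (esym Fp).
have [k_gt0 Fkp _] := lpk.
case: (ltngtP k n) (dvdn_leq n_gt0 dvdkn) => // [ltkn|eqkn] _; last first.
  by rewrite -eqkn.
have [|c' /andP[dc' c'p] Fc'] := below k p _ (divn k dvdkn) pe Fkp.
  by rewrite k_gt0.
have := ltp c'; rewrite Fc' ltxx c'p ltW//.
by move=> /(_ isT).
Qed.

(** * The gap between fixed points of the square *)

Lemma least_point_of_cycle (R : realType) (f : R -> R) (n : nat) (x : R) :
  least_period f n x ->
  exists2 a, least_period f n a & forall k, (a <= iter k f a)%R.
Proof.
move=> [n_gt0 fn least].
pose F (i : 'I_n) := iter i f x.
case: (@arg_minP _ _ _ (Ordinal n_gt0) xpredT F isT) => i _ mini.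
exists (F i) => [|k].
  split=> // [|k kn]; first by rewrite /F -iterD addnC iterD fn.
  move=> fk; apply: (least k kn).
  have := congr1 (iter (n - i) f) fk.
  rewrite /F -!iterD (addnC (n - i)%N) -addnA subnK ?(ltnW (ltn_ord i))//.
  by rewrite iterD fn.
have lt_mod : ((k + i) %% n < n)%N by rewrite ltn_mod.
rewrite /F -iterD (divn_eq (k + i) n) addnC iterD iter_mul_fixed//.
exact: (mini (Ordinal lt_mod)).
Qed.

(** The common source of the points of period 2, of odd and of even period: [a]
    is the least point of a cycle of length [n], [v] is sent to the predecessor of
    [a] in this cycle, and [y], [w] are the fixed points of [f o f] adjacent to
    [v]. *)
Record square_gap (R : realType) (f : R -> R) (n : nat) (a y v w z : R) : Prop
  := SquareGap {
  gap_period : least_period f n a;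
  gap_least : forall k, (a <= iter k f a)%R;
  gap_ay : (a < y)%R;
  gap_yv : (y < v)%R;
  gap_vw : (v < w)%R;
  gap_wz : (w <= z)%R;
  gap_fz : f z = z;
  gap_ffy : f (f y) = y;
  gap_ffw : f (f w) = w;
  gap_fv : f v = iter n.-1 f a;
  gap_ffv : f (f v) = a;
  gap_below : forall x, (y < x < w)%R -> (f (f x) < x)%R;
  gap_above : forall x, (y <= x < w)%R -> (z < f x)%R }.

(** Some point [p] of the cycle below [b = f^(n-1) a] is sent to [b] or above:
    otherwise the cycle could never climb from [a] to [b].  As [f b = a < b],
    there is a fixed point [z] between [p] and [b], and [v] is found between
    [p] and [z].  The hypothesis [n > 2] gives [f (f a) <> a], so that [f o f]
    has a fixed point strictly between [a] and [v]. *)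
Lemma period_square_gap (R : realType) (f : R -> R) (n : nat) (x : R) :
  continuous f -> (2 < n)%N -> least_period f n x ->
  exists a y v w z, square_gap f n a y v w z.
Proof.
move=> cf n_gt2 /least_point_of_cycle[a lpa mina].
have [n_gt0 fna least] := lpa.
have cf2 : continuous (iter 2 f) := continuous_iter (n := 2) cf.
have cid : continuous (@id R) by move=> ?; exact: cvg_id.
have ccst (c : R) : continuous (fun _ : R => c) by move=> ?; exact: cvg_cst.
have above_a k : (0 < k < n)%N -> (a < iter k f a)%R.
  move=> /least ne; rewrite lt_neqAle mina andbT; apply/eqP => ea.
  exact: ne (esym ea).
pose b := iter n.-1 f a.
have fb : f b = a by rewrite /b -iterS prednK.
have ltab : (a < b)%R by apply: above_a; lia.
have [i bi mini] : exists2 i, (b <= iter i.+1 f a)%R & (iter i f a < b)%R.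
  have ex : exists i, (b <= iter i.+1 f a)%R.
    by exists n.-2; rewrite prednK ?lexx//; lia.
  case: (ex_minnP ex) => i bi mini; exists i => //.
  case: i bi mini => // i _ mini.
  by rewrite ltNge; apply/negP => /mini; rewrite ltnn.
set p := iter i f a in bi mini; rewrite iterS -/p in bi.
have leap : (a <= p)%R := mina i.
have [z [/andP[lepz ltzb] fz _]] :=
  @last_crossing R f id p b cf cid (ltW mini) (le_trans (ltW mini) bi)
    (eq_ind_r (fun t => t < b)%R ltab fb).
have [|v [/andP[lepv ltvz] fv _]] :=
  @last_crossing R f (fun=> b) p z cf (ccst b) lepz bi; first by rewrite fz.
have ffv : f (f v) = a by rewrite fv.
have ff_a : (a < f (f a))%R by apply: (above_a 2).
have ltav : (a < v)%R.
  rewrite lt_neqAle (le_trans leap lepv) andbT; apply/eqP => eav.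
  by move: ff_a; rewrite {2}eav ffv ltxx.
have [||y [/andP[leay ltyv] ffy lty]] :=
  @last_crossing R (iter 2 f) id a v cf2 cid (ltW ltav).
- exact: ltW.
- by rewrite /= ffv.
have [||w [/andP[ltvw lewz] ffw ltw]] :=
  @first_crossing R (iter 2 f) id v z cf2 cid (ltW ltvz).
- by rewrite /= ffv.
- by rewrite /= !fz.
have below t : (y < t < w)%R -> (f (f t) < t)%R.
  move=> /andP[yt tw]; have [tv|vt] := leP t v.
    by apply: lty; rewrite yt.
  by apply: ltw; rewrite tw ltW.
(* [f u = z] would give [f (f u) = z], which is above [u], while [f o f] is
   below the diagonal on the gap. *)
have off u : (y <= u < w)%R -> f u <> z.
  rewrite le_eqVlt => /andP[/orP[/eqP eyu|yu] uw fu].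
    by move: ffy; rewrite /= eyu fu fz; lra.
  by have := below u; rewrite yu uw fu fz => /(_ isT); lra.
exists a, y, v, w, z; split=> //.
  rewrite lt_neqAle leay andbT; apply/eqP => eay.
  by move: ffy ff_a; rewrite eay /= => ->; rewrite ltxx.
move=> t /andP[yt tw]; rewrite ltNge; apply/negP => ftz.
have [tv|vt] := leP t v.
  have [|u [/andP[tu uv] zu _]] :=
    @last_crossing R (fun=> z) f t v (ccst z) cf tv ftz; first by rewrite fv.
  by apply: (off u) => //; apply/andP; split; lra.
have [||u [/andP[vu ut] zu _]] :=
  @first_crossing R (fun=> z) f v t (ccst z) cf (ltW vt).
- by rewrite fv.
- by [].
by apply: (off u) => //; apply/andP; split; lra.
Qed.

(** * Periods 1, 2 and larger odd periods *)

Lemma period2_of_period_gt2 (R : realType) (f : R -> R) (n : nat) (x : R) :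
  continuous f -> (2 < n)%N -> least_period f n x ->
  exists y, least_period f 2 y.
Proof.
move=> cf n_gt2 lpx.
have [a [y [v [w [z gap]]]]] := period_square_gap cf n_gt2 lpx.
exists y; split=> //; first exact: gap_ffy gap.
case=> [|[|k]]// _ /= fy.
have := gap_above gap (x := y); rewrite fy lexx.
have := gap_yv gap; have := gap_vw gap; have := gap_wz gap.
move=> wz vw yv /(_ (lt_trans yv vw)); lra.
Qed.

Lemma fixed_point_of_period_gt1 (R : realType) (f : R -> R) (n : nat) (x : R) :
  continuous f -> (1 < n)%N -> least_period f n x ->
  exists y, least_period f 1 y.
Proof.
move=> cf n_gt1 /least_point_of_cycle[a [n_gt0 fn least] mina].
pose b := iter n.-1 f a.
have fb : f b = a by rewrite /b -iterS prednK.
have ltab : (a < b)%R.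
  by rewrite lt_neqAle mina andbT; apply/eqP => /esym; apply: least; lia.
have cid : continuous (@id R) by move=> ?; exact: cvg_id.
have [||z [_ fz _]] := @last_crossing R f id a b cf cid (ltW ltab).
- exact: (mina 1).
- by rewrite fb.
by exists z; split=> // -[|[|k]].
Qed.

(** Descent in steps of 2 on [(y, v]].  It starts at [n + 2], because
    [f^(n+2) v = f^n a = a < y], whereas odd iterates of [f] move [y] up. *)
Lemma larger_odd_periods (R : realType) (f : R -> R) (n m : nat) (x : R) :
  continuous f -> odd n -> (1 < n)%N -> least_period f n x ->
  odd m -> (n < m)%N -> exists y, least_period f m y.
Proof.
move=> cf n_odd n_gt1 lpx m_odd ltnm.
have n_gt2 : (2 < n)%N by lia.
have [a [y [v [w [z gap]]]]] := period_square_gap cf n_gt2 lpx.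
have yv := gap_yv gap; have vw := gap_vw gap; have wz := gap_wz gap.
have cid : continuous (@id R) by move=> ?; exact: cvg_id.
have ltyf : (y < f y)%R.
  have := gap_above gap (x := y).
  by rewrite lexx (lt_trans yv vw) => /(_ isT); lra.
have iter_odd_y k : odd k -> iter k f y = f y.
  move=> k_odd; rewrite -(odd_double_half k) k_odd iterD -muln2.
  by rewrite (@iter_mul_fixed _ _ 2 y)//; exact: gap_ffy gap.
have fixed_below k c : odd k -> (y < c <= v)%R -> (iter k f c < c)%R ->
    exists2 c', (y < c' < c)%R & iter k f c' = c'.
  move=> k_odd /andP[yc cv] fc.
  have [||p [/andP[yp pc] fp _]] := @first_crossing R id (iter k f) y c cid
    (continuous_iter (n := k) cf) (ltW yc).
  - by rewrite iter_odd_y.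
  - exact: ltW.
  exists p => //; rewrite yp lt_neqAle pc andbT; apply/eqP => epc.
  by move: fc; rewrite -epc -fp ltxx.
have [|||||p _ lpp] := @least_period_by_descent R f 2 m y v cf.
- by lia.
- by move=> k /dvdn_odd /(_ m_odd) k_odd; rewrite !modn2 k_odd m_odd.
- move=> k c _; rewrite !modn2 m_odd => k_odd /andP[yc cv] fkc.
  apply: fixed_below; first by rewrite oddD; case: (odd k) k_odd.
    by rewrite yc.
  rewrite addnC iterD fkc; apply: (gap_below gap).
  by rewrite yc (le_lt_trans cv).
- by rewrite iter_odd_y.
- have [|||c /andP[yc cv] fc] := fixed_below n.+2 v.
  + by rewrite /= n_odd.
  + by rewrite yv lexx.
  + rewrite -addn2 iterD /= (gap_ffv gap).
    by have [_ -> _] := gap_period gap; apply: lt_trans yv; apply: gap_ay gap.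
  exists n.+2, c; split=> //.
  + by lia.
  + by rewrite !modn2 /= n_odd m_odd.
  + by rewrite yc ltW.
by exists p.
Qed.

(** * Even periods *)

(** [G] stretches both [[d, u]] and [[u, e]] over [[d, e]].  If [G^k c = c] then
    [G^k] goes from [e] at [d] down to [c <= u] at [c], so it takes the value
    [u] at some [t < c]; then [G^(k+1) t = d], which forces a fixed point of
    [G^(k+1)] between [d] and [t]. *)
Lemma horseshoe_periods (R : realType) (G : R -> R) (d u e : R) (n : nat) :
  continuous G -> (d < u < e)%R -> G d = e -> G e = e -> G u = d ->
  (0 < n)%N -> exists2 c, (d < c <= u)%R & least_period G n c.
Proof.
move=> cG /andP[du ue] Gd Ge Gu n_gt0.
have cid : continuous (@id R) by move=> ?; exact: cvg_id.
have ccst (c : R) : continuous (fun _ : R => c) by move=> ?; exact: cvg_cst.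
have iter_d k : (0 < k)%N -> iter k G d = e.
  by case: k => // k _; rewrite iterSr Gd iter_fix.
have fixed_below k t : (0 < k)%N -> (d < t <= u)%R -> iter k G t = d ->
    exists2 p, (d < p <= t)%R & iter k G p = p.
  move=> k_gt0 /andP[dt tu] Gt.
  have [||p [dpt Gp _]] := @first_crossing R id (iter k G) d t cid
    (continuous_iter (n := k) cG) (ltW dt).
  - by rewrite iter_d//=; lra.
  - by rewrite Gt ltW.
  by exists p.
apply: (least_period_by_descent (s := 1) cG n_gt0).
- by move=> k _; rewrite !modn1.
- move=> k c k_gt0 _ /andP[dc cu] Gc.
  have ltcu : (c < u)%R.
    rewrite lt_neqAle cu andbT; apply/eqP => ecu.
    case: k k_gt0 Gc => // k _; rewrite ecu iterSr Gu.
    by case: (posnP k) => [->/=|/iter_d ->]; lra.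
  have [||t [/andP[dt tc] Gt _]] := @first_crossing R (fun=> u) (iter k G) d c
    (ccst u) (continuous_iter (n := k) cG) (ltW dc).
  - by rewrite iter_d.
  - by rewrite Gc.
  have lttc : (t < c)%R.
    rewrite lt_neqAle tc andbT; apply/eqP => etc.
    by move: ltcu; rewrite Gt etc Gc ltxx.
  have [|||p /andP[dp pt] Gp] := fixed_below (k + 1)%N t.
  - by rewrite addn1.
  - by rewrite dt; lra.
  - by rewrite addn1 iterS -Gt.
  by exists p => //; rewrite dp (le_lt_trans pt).
- by rewrite iter_d//; lra.
- have [|||p /andP[dp pu] Gp] := fixed_below 1%N u => //.
    by rewrite du lexx.
  by exists 1%N, p; split; rewrite ?modn1 ?dp.
Qed.

(** The point found has least period [j] under [f o f].  Its least period under
    [f] is then [2 j] unless it is odd, in which case [f c] would belong to the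
    orbit of [c] under [f o f]; this is impossible, as that orbit stays below
    [w <= z] while [f c > z]. *)
Lemma even_periods (R : realType) (f : R -> R) (n j : nat) (x : R) :
  continuous f -> odd n -> (1 < n)%N -> least_period f n x ->
  (0 < j)%N -> exists y, least_period f (2 * j) y.
Proof.
move=> cf n_odd n_gt1 lpx j_gt0.
have n_gt2 : (2 < n)%N by lia.
have [a [y [v [w [z gap]]]]] := period_square_gap cf n_gt2 lpx.
have yv := gap_yv gap; have vw := gap_vw gap; have wz := gap_wz gap.
have ffy := gap_ffy gap; have ffw := gap_ffw gap.
have ccst (c : R) : continuous (fun _ : R => c) by move=> ?; exact: cvg_cst.
have cf2 : continuous (iter 2 f) := continuous_iter (n := 2) cf.
have ltaw : (a < w)%R.
  by apply: lt_trans (lt_trans yv vw); apply: gap_ay gap.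
(* The orbit of [a] under [f o f] starts below [w] and reaches [f v > z >= w]
   because [n] is odd; [q] is the point from which it first jumps over [w]. *)
have [q leaq [ltqw leffq]] : exists2 q, (a <= q)%R &
    (q < w)%R /\ (w <= f (f q))%R.
  have ex : exists i, (w <= iter (i.+1).*2 f a)%R.
    exists (n.-1./2).-1; rewrite prednK; last by lia.
    rewrite (_ : _.*2 = n.-1); last by lia.
    rewrite -(gap_fv gap) (le_trans wz)// ltW// (gap_above gap)//.
    by rewrite ltW.
  case: (ex_minnP ex) => i wi mini.
  exists (iter i.*2 f a); first exact: gap_least gap _.
  split; last exact: wi.
  case: i wi mini => // i _ mini.
  by rewrite ltNge; apply/negP => /mini; rewrite ltnn.
have ltqy : (q < y)%R.
  rewrite ltNge le_eqVlt; apply/negP => /orP[/eqP eyq|ltyq].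
    by move: leffq; rewrite -eyq ffy; lra.
  by have := gap_below gap (x := q); rewrite ltyq ltqw => /(_ isT); lra.
have [|d [/andP[leqd ltdy] ffd ltd]] :=
  @last_crossing R (iter 2 f) (fun=> w) q y cf2 (ccst w) (ltW ltqy) leffq.
  by rewrite /= ffy; lra.
have below t : (d < t < w)%R -> (f (f t) < w)%R.
  move=> /andP[dt tw]; have [ty|yt] := leP t y; first by apply: ltd; rewrite dt.
  by apply: (lt_trans _ tw); apply: (gap_below gap); rewrite yt.
have above t : (d < t < w)%R -> (z < f t)%R.
  move=> /andP[dt tw]; have [yt|ty] := leP y t.
    by apply: (gap_above gap); rewrite yt.
  rewrite ltNge; apply/negP => ftz.
  have [|s [/andP[ts sy] zs _]] :=
    @last_crossing R (fun=> z) f t y (ccst z) cf (ltW ty) ftz.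
    by apply: (gap_above gap); rewrite lexx (lt_trans yv vw).
  have := below s; rewrite -zs (gap_fz gap) (lt_le_trans dt ts) (lt_trans sy)//.
    by move=> /(_ isT); lra.
  exact: lt_trans vw.
(* [f o f] may leave [[d, w]] downwards; truncating it at [d] confines it to
   this interval.  A periodic orbit of [G] that avoids [d] is an orbit of
   [f o f], and [d] is avoided because it is sent to the fixed point [w]. *)
pose G := ((fun=> d) \max iter 2 f)%R.
have cG : continuous G.
  by move=> t; apply: continuous_max; [exact: ccst|exact: cf2].
have ltdw : (d < w)%R by lra.
have Gd : G d = w.
  by rewrite /G /= (_ : f (f d) = w)//; apply/max_idPr; exact: ltW.
have Gw : G w = w by rewrite /G /= ffw; apply/max_idPr; exact: ltW.
have Gv : G v = d.
  by rewrite /G /= (gap_ffv gap); apply/max_idPl; exact: le_trans leqd.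
have [c /andP[dc cv] lpc] : exists2 c, (d < c <= v)%R & least_period G j c.
  by apply: horseshoe_periods cG _ Gd Gw Gv j_gt0; rewrite vw andbT; lra.
have [_ Gc leastc] := lpc.
have orbit i : (d < iter i G c <= w)%R /\ iter i (iter 2 f) c = iter i G c.
  elim: i => [|i [/andP[dGi Giw] IHi]].
    by rewrite /= dc; split=> //; lra.
  have neqd : iter i.+1 G c <> d.
    move=> Gid; have := iter_mul_fixed (i.+2) Gc.
    rewrite -(subnK (leq_pmulr i.+2 j_gt0)) iterD [iter i.+2 G c]iterS Gid Gd.
    by rewrite iter_fix//; lra.
  have ltdG : (d < iter i.+1 G c)%R.
    rewrite lt_neqAle; apply/andP; split; first by apply/eqP => /esym.
    by rewrite /= {1}/G /= le_max lexx.
  have GE : iter i.+1 G c = iter 2 f (iter i G c).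
    move: ltdG; rewrite iterS {1 3}/G /= /Num.max.
    by case: ifP => // _; rewrite ltxx.
  split; last by rewrite GE iterS IHi.
  rewrite ltdG GE /=; move: Giw; rewrite le_eqVlt => /orP[/eqP->|Giw].
    by rewrite ffw.
  by apply/ltW/below; rewrite dGi.
exists c; split=> [||k /andP[k_gt0 ltk] fk].
- by rewrite muln_gt0.
- by rewrite mulnC iterM (orbit j).2.
have [k_odd|k_even] := boolP (odd k).
  have : f c = iter (k.+1./2) G c.
    rewrite -(orbit _).2 -iterM -[in LHS]fk -iterS.
    by congr (iter _ f c); clear -k_odd; lia.
  have /andP[_ lew] := (orbit (k.+1./2)).1.
  have : (z < f c)%R by apply: above; rewrite dc; lra.
  by move=> + fcE; rewrite fcE; lra.
apply: (leastc k./2); first by clear -k_gt0 ltk k_even; lia.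
rewrite -(orbit _).2 -iterM -[RHS]fk.
by congr (iter _ f c); clear -k_even; lia.
Qed.

(** * Powers of two and the Sharkovsky order *)

Lemma least_period_iter (T : Type) (f : T -> T) (q e : nat) (x : T) :
  (0 < q)%N -> least_period f (q * e) x -> least_period (iter q f) e x.
Proof.
move=> q_gt0 [qe_gt0 fx least]; split.
- by move: qe_gt0; rewrite muln_gt0 => /andP[].
- by rewrite -iterM mulnC.
- move=> k /andP[k_gt0 ltke]; rewrite -iterM mulnC; apply: least.
  by rewrite muln_gt0 q_gt0 k_gt0 ltn_mul2l q_gt0.
Qed.

(** The least period of [x] under [f] is [2 e], except that it may be [e] when
    [e] is odd; in that case [even_periods] provides another point, of period
    [2 e]. *)
Lemma double_period (R : realType) (f : R -> R) (e : nat) :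
  continuous f -> (1 < e)%N -> (exists x, least_period (iter 2 f) e x) ->
  exists y, least_period f (2 * e) y.
Proof.
move=> cf e_gt1 [x lpx]; have [e_gt0 ffx least] := lpx.
have iter2M k : iter k f x = x -> iter k (iter 2 f) x = x.
  by move=> fk; rewrite -iterM mulnC iter_mul_fixed.
have odd_period k : (0 < k < 2 * e)%N -> iter k f x = x -> odd k /\ k = e.
  move=> /andP[k_gt0 ltk] fk.
  have /dvdnP[q kqe] := least_period_dvd lpx (iter2M k fk).
  have ke : k = e.
    case: q kqe => [|[|q]] kqe; [lia|lia|].
    by have := leq_mul (isT : (2 <= q.+2)%N) (leqnn e); lia.
  split; last exact: ke.
  rewrite ke; have [//|e_even] := boolP (odd e).
  exfalso; apply: (least e./2); first by lia.
  by rewrite -iterM (_ : e./2 * 2 = k)%N//; lia.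
have [fe|fe] := pselect (iter e f x = x).
  have [e_odd _] : odd e /\ e = e by apply: odd_period => //; lia.
  apply: (even_periods (n := e) (x := x)) => //; split=> // k /andP[k_gt0 ltke].
  by move=> /odd_period[|_ ke]; lia.
exists x; split; [lia|by rewrite mulnC iterM|].
by move=> k kbound fk; have [_ ke] := odd_period k kbound fk; rewrite ke in fk.
Qed.

Lemma pow2_multiple_period (R : realType) (f : R -> R) (k e : nat) :
  continuous f -> (1 < e)%N -> (exists x, least_period (iter (2 ^ k) f) e x) ->
  exists y, least_period f (2 ^ k * e) y.
Proof.
elim: k f => [|k IHk] f cf e_gt1 [x lpx]; first by exists x; rewrite mul1n.
rewrite expnS -mulnA; apply: double_period => //.
  by rewrite (leq_trans e_gt1)// leq_pmull// expn_gt0.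
apply: IHk e_gt1 _; first exact: (continuous_iter (n := 2)).
exists x; suff <- : iter (2 ^ k.+1) f = iter (2 ^ k) (iter 2 f) by [].
by apply/funext => t; rewrite expnSr iterM.
Qed.

(** For [l > 0], the map [f^(2^(l-1))] has a point of period
    [2^(k-l+1) > 2], hence one of period 2. *)
Lemma smaller_pow2_period (R : realType) (f : R -> R) (l k : nat) (x : R) :
  continuous f -> (l < k)%N -> least_period f (2 ^ k) x ->
  exists y, least_period f (2 ^ l) y.
Proof.
move=> cf ltlk lpx.
case: l ltlk => [|l] ltlk.
  by apply: fixed_point_of_period_gt1 cf _ lpx; rewrite -(expn0 2) ltn_exp2l.
rewrite expnSr; apply: pow2_multiple_period => //.
apply: (@period2_of_period_gt2 _ _ (2 ^ (k - l)) x).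
- exact: continuous_iter.
- by rewrite (@leq_trans (2 ^ 2))// leq_exp2l//; lia.
- by apply: least_period_iter; rewrite ?expn_gt0// -expnD subnKC//; lia.
Qed.

Lemma even_multiple_period (R : realType) (f : R -> R) (s q j : nat) (x : R) :
  continuous f -> odd q -> (1 < q)%N -> least_period f (2 ^ s * q) x ->
  (0 < j)%N -> exists y, least_period f (2 ^ s * (2 * j)) y.
Proof.
move=> cf q_odd q_gt1 lpx j_gt0; apply: pow2_multiple_period => //; first lia.
apply: (@even_periods _ _ q j x) => //; first exact: continuous_iter.
by apply: least_period_iter; rewrite ?expn_gt0.
Qed.

(** Writing [n = 2^s q] with [q] odd, [even_multiple_period] gives a power of
    two as large as desired among the periods of [f], and the smaller powers of
    two follow. *)
Lemma pow2_period_of_other (R : realType) (f : R -> R) (l n : nat) (x : R) :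
  continuous f -> ~ is_pow2 n -> least_period f n x ->
  exists y, least_period f (2 ^ l) y.
Proof.
move=> cf n_npow2 lpx; have [n_gt0 _ _] := lpx.
have [q q_odd nE] := pfactor_coprime (isT : prime 2) n_gt0.
set s := logn 2 n in nE; rewrite coprime2n in q_odd.
have q_gt1 : (1 < q)%N.
  case: q q_odd nE => [|[|q]]// _ nE; exfalso; apply: n_npow2.
  by exists s; rewrite nE mul1n.
rewrite nE mulnC in lpx.
have [t lpt] := even_multiple_period cf q_odd q_gt1 lpx (expn_gt0 2 l).
apply: (@smaller_pow2_period _ _ l (s + l.+1) t cf); first lia.
by rewrite expnD expnS.
Qed.

Unset Implicit Arguments.

Theorem theorem1 (R : realType) (f : R -> R) (hf : continuous f)
  (n : nat) (hn : exists x : R, least_period f n x)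
  (m : nat) (hm : (0 < m)%N) (hmn : sharkovsky_lt m n) :
  exists y : R, least_period f m y.
Proof.
move: hn hm; case: hmn => {m n} [l k ltlk|_ n [l ->] n_gt0 n_npow2|
    k l m n m_odd m_gt1 n_odd n_gt1 ltlk|k m n m_odd m_gt1 n_odd n_gt1 ltnm]
    [x lpx] _.
- exact: smaller_pow2_period hf ltlk lpx.
- exact: pow2_period_of_other hf n_npow2 lpx.
- have [|y] :=
    even_multiple_period (j := 2 ^ (k - l.+1) * m) hf n_odd n_gt1 lpx.
    by rewrite muln_gt0 expn_gt0; lia.
  by rewrite !mulnA -expnSr -expnD subnKC//; exists y.
- apply: pow2_multiple_period => //.
  apply: (@larger_odd_periods _ _ n m x) => //; first exact: continuous_iter.
  by apply: least_period_iter; rewrite ?expn_gt0.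
Qed.
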